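(* Consider the mixed-discrete bi-objective problem $(\mathbf{P})$, its subproblems $(\mathbf{P}_k)$, $k\in\mathcal{K}$, and the sets $\mathcal{X}^\star$, $\mathcal{X}_k^\star$, $\mathcal{K}_1^m$, $\mathcal{K}_\emptyset^u$ and $\mathcal{K}_1^u=\mathcal{K}\setminus\mathcal{K}_\emptyset^u$ defined in the context. Then the Pareto front constructed with the subproblem set $\mathcal{K}_1^u$ is identical to the true Pareto front $\mathcal{X}^\star$, that is, $$\left\{\mathbf{x}^\dagger\in\bigcup_{k\in\mathcal{K}_1^u}\mathcal{X}_k^\star \;\middle|\; \nexists\,\mathbf{x}\in\Big(\bigcup_{k\in\mathcal{K}_1^u}\mathcal{X}_k^\star\Big)\setminus\{\mathbf{x}^\dagger\}\ \text{such that}\ \mathbf{J}(\mathbf{x})\le\mathbf{J}(\mathbf{x}^\dagger)\right\}=\mathcal{X}^\star .$$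
   Context: **Order convention.** For $\mathbf{a},\mathbf{b}\in\mathbb{R}^2$, $\mathbf{a}\le\mathbf{b}$ (equivalently $\mathbf{b}\ge\mathbf{a}$) denotes Pareto dominance of $\mathbf{b}$ by $\mathbf{a}$ in minimization: $a_1\le b_1$, $a_2\le b_2$ and $\mathbf{a}\ne\mathbf{b}$. (In the constraints $\mathbf{g}\le 0$ below, and for scalars, $\le$ is the usual componentwise inequality.) **Problem $(\mathbf{P})$.** The design vector is $\mathbf{x}=[\mathbf{y}\ \mathbf{z}]$ with continuous part $\mathbf{y}=[y_1,\dots,y_{n_y}]$ and discrete part $\mathbf{z}=[z_1,\dots,z_{n_z}]$. The problem is to minimize, in the Pareto sense, $\mathbf{J}(\mathbf{x})=[J_1(\mathbf{y},\mathbf{z}),\,J_2(\mathbf{y},\mathbf{z})]^\top\in\mathbb{R}^2$ subject to $\mathbf{g}(\mathbf{y},\mathbf{z})\le 0$, $\mathbf{h}(\mathbf{y},\mathbf{z})=0$, where $\mathbf{g}$ and $\mathbf{h}$ are real vector-valued functions, $y_i\in[l_i,u_i]$ for $i=1,\dots,n_y$, and $z_j\in Z_j$ for $j=1,\dots,n_z$, where each $Z_j$ is a finite set. Let $\mathcal{X}$ be the set of feasible design vectors. The set of Pareto optimal solutions (the true Pareto front) is $$\mathcal{X}^\star=\{\mathbf{x}^\star\in\mathcal{X}\mid \nexists\,\mathbf{x}\in\mathcal{X}\setminus\{\mathbf{x}^\star\}\text{ s.t. }\mathbf{J}(\mathbf{x})\le\mathbf{J}(\mathbf{x}^\star)\}.$$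 **Subproblems $(\mathbf{P}_k)$.** Let $\mathcal{Z}=Z_1\times\cdots\times Z_{n_z}$, $\mathcal{K}=\{1,\dots,|\mathcal{Z}|\}$, and let $\mathbf{z}_k$ be the $k$-th element of $\mathcal{Z}$ in a fixed enumeration. $(\mathbf{P}_k)$ is the problem $(\mathbf{P})$ with $\mathbf{z}=\mathbf{z}_k$ fixed. Let $\mathcal{Y}_k$ be the set of feasible continuous design vectors of $(\mathbf{P}_k)$, i.e. those $\mathbf{y}$ with $y_i\in[l_i,u_i]$ for all $i$, $\mathbf{g}(\mathbf{y},\mathbf{z}_k)\le 0$ and $\mathbf{h}(\mathbf{y},\mathbf{z}_k)=0$. The set of Pareto optimal solutions of $(\mathbf{P}_k)$ is $$\mathcal{X}_k^\star=\{\mathbf{x}^\star\in\mathcal{Y}_k\times\{\mathbf{z}_k\}\mid \nexists\,\mathbf{y}\in\mathcal{Y}_k\text{ s.t. }\mathbf{J}([\mathbf{y},\mathbf{z}_k])\le\mathbf{J}(\mathbf{x}^\star)\}.$$ **Standing premise of the decomposition.** $\mathcal{X}^\star$ is obtained by solving all subproblems and keeping the solutions that are non-dominated among them: $\mathcal{X}^\star=\{\mathbf{x}^\star\in\bigcup_{k\in\mathcal{K}}\mathcal{X}_k^\star\mid\nexists\,\mathbf{x}\in\bigcup_{k\in\mathcal{K}}\mathcal{X}_k^\star\text{ s.t. }\mathbf{J}(\mathbf{x})\le\mathbf{J}(\mathbf{x}^\star)\}$. **Utopia points.** For every $k\in\mathcal{K}$ and $i\in\{1,2\}$, $J_i(\cdot,\mathbf{z}_k)$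 attains its minimum over $\mathcal{Y}_k$ (at an anchor solution $\mathbf{y}_{k,i}^\sharp\in\arg\min_{\mathbf{y}\in\mathcal{Y}_k}J_i(\mathbf{y},\mathbf{z}_k)$). The utopia point of $(\mathbf{P}_k)$ is $$\mathbf{J}_k^u=\Big[\min_{\mathbf{y}\in\mathcal{Y}_k}J_1(\mathbf{y},\mathbf{z}_k),\ \min_{\mathbf{y}\in\mathcal{Y}_k}J_2(\mathbf{y},\mathbf{z}_k)\Big]^\top .$$ **Pruning sets.** The index set of subproblems with non-dominated utopia points is $$\mathcal{K}_1^m=\{k\in\mathcal{K}\mid\nexists\, l\in\mathcal{K}\setminus\{k\}\text{ s.t. }\mathbf{J}_l^u\le\mathbf{J}_k^u\}.$$ Put $\mathcal{X}^\star_{\mathcal{K}_1^m}=\bigcup_{k\in\mathcal{K}_1^m}\mathcal{X}_k^\star$ (the master front). The pruned and remaining index sets are $$\mathcal{K}_\emptyset^u=\{k\in\mathcal{K}\mid\exists\,\mathbf{x}\in\mathcal{X}^\star_{\mathcal{K}_1^m}\text{ s.t. }\mathbf{J}_k^u\ge\mathbf{J}(\mathbf{x})\},\qquad \mathcal{K}_1^u=\mathcal{K}\setminus\mathcal{K}_\emptyset^u .$$ *)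

(* Defs.v *)
From mathcomp Require Import all_boot all_order all_algebra.
From mathcomp Require Import boolp classical_sets reals.

Set Implicit Arguments.
Unset Strict Implicit.
Unset Printing Implicit Defensive.

Import Order.TTheory GRing.Theory Num.Theory.
Local Open Scope classical_set_scope.
Local Open Scope ring_scope.

(* The constraint z_j \in Z_j is carried by the type of z: each Z_j is an
   arbitrary (possibly empty) finite type. *)
Record problem (R : realType) := Problem {
  ny : nat;
  nz : nat;
  ng : nat;
  nh : nat;
  Z : 'I_nz -> finType;
  lower : 'rV[R]_ny;
  upper : 'rV[R]_ny;
  J : 'rV[R]_ny * {dffun forall j : 'I_nz, Z j} -> 'cV[R]_2;
  ineq_con : 'rV[R]_ny * {dffun forall j : 'I_nz, Z j} -> 'cV[R]_ng;
  eq_con : 'rV[R]_ny * {dffun forall j : 'I_nz, Z j} -> 'cV[R]_nh }.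

Arguments Z {R} p j.

(* Pareto dominance for minimization: a dominates b. *)
Definition dominates (R : realType) (a b : 'cV[R]_2) : Prop :=
  (forall i, a i 0 <= b i 0) /\ a <> b.

Definition argmin (R : realType) (T : Type) (A : set T) (f : T -> R) : set T :=
  [set a | A a /\ forall b, A b -> f a <= f b].

(* The least element of A; the value 0 is a default, used only when A has no
   least element. *)
Definition minimum (R : realType) (A : set R) : R := xget 0 (A `&` lbound A).

Section Problem.
Variables (R : realType) (P : problem R).

Definition yvec : Type := 'rV[R]_(ny P).
Definition zvec : finType := {dffun forall j : 'I_(nz P), Z P j}.
Definition design : Type := (yvec * zvec)%type.

Definition feasible : set design :=
  [set x : design |
    [/\ forall i, lower P 0 i <= x.1 0 i <= upper P 0 i,
        forall i, ineq_con x i 0 <= 0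
      & eq_con x = 0]].

Definition pareto_front (S : set design) : set design :=
  [set xs : design | S xs /\ ~ exists2 x, (S `\ xs) x & dominates (J x) (J xs)].

Definition pareto_optimal : set design := pareto_front feasible.

Definition subproblem : finType := 'I_#|zvec|.

(* zk enumerates the discrete vectors; it is assumed bijective where used. *)
Variable zk : subproblem -> zvec.

Definition subfeasible (k : subproblem) : set yvec :=
  [set y : yvec | feasible (y, zk k)].

Definition subpareto (k : subproblem) : set design :=
  [set xs : design | (subfeasible k `*` [set zk k]) xs /\
    ~ exists2 y, subfeasible k y & dominates (J (y, zk k)) (J xs)].

Definition subobjective (k : subproblem) (i : 'I_2) (y : yvec) : R :=
  J (y, zk k) i 0.

Definition utopia (k : subproblem) : 'cV[R]_2 :=
  \col_i minimum (subobjective k i @` subfeasible k).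

Definition K1m : set subproblem :=
  [set k | ~ exists2 l, l <> k & dominates (utopia l) (utopia k)].

Definition master_front : set design := \bigcup_(k in K1m) subpareto k.

Definition Kempty : set subproblem :=
  [set k | exists2 x, master_front x & dominates (J x) (utopia k)].

Definition K1u : set subproblem := ~` Kempty.

End Problem.

Arguments pareto_optimal {R} P _.

(* Main.v *)
Require Import Defs.
From mathcomp Require Import all_boot all_order all_algebra.
From mathcomp Require Import boolp classical_sets reals.

(** By the decomposition premise, the true front consists of the points that are
    not dominated when the Pareto points of all subproblems compete; pruning has
    to preserve this set ([pareto_front_K1u]).

    Each utopia point weakly dominates every point of its own subproblem, so a
    point that dominates the utopia point of [k] dominates every Pareto point
    of [k] ([dominates_subpareto]).  Hence a pruned subproblem contributes
    nothing to the true front, and the front is contained in what the remaining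
    subproblems offer.

    For the converse, a point surviving among the remaining subproblems must
    not be dominated by a point of a pruned subproblem [k].  If it were, the
    master-front point that caused [k] to be pruned would dominate it as well.
    That witness is still a competitor, because the subproblems that build the
    master front are never pruned themselves ([K1m_sub_K1u]): a master point
    dominating the utopia point of [m] comes from some [l], and then the utopia
    point of [l] dominates that of [m].  So one replacement of the dominating
    point is enough, with no descent along a chain of witnesses. *)

Import Order.TTheory.

Local Open Scope classical_set_scope.
Local Open Scope ring_scope.

Section Dominance.
Variable R : realType.
Implicit Types a b c : 'cV[R]_2.

Lemma dominates_irrefl a : ~ dominates a a.
Proof. by case. Qed.

Lemma weak_dominates_antisym a b :
  (forall i, a i 0 <= b i 0) -> (forall i, b i 0 <= a i 0) -> a = b.
Proof.
move=> leab leba; apply/colP => i.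
by apply: le_anti; rewrite leab leba.
Qed.

Lemma dominates_le_trans a b c :
  dominates a b -> (forall i, b i 0 <= c i 0) -> dominates a c.
Proof.
move=> [leab neab] lebc; split=> [i|eac]; first exact: le_trans (leab i) (lebc i).
by apply: neab; apply: weak_dominates_antisym => // i; rewrite eac.
Qed.

Lemma le_dominates_trans a b c :
  (forall i, a i 0 <= b i 0) -> dominates b c -> dominates a c.
Proof.
move=> leab [lebc nebc]; split=> [i|eac]; first exact: le_trans (leab i) (lebc i).
by apply: nebc; apply: weak_dominates_antisym => // i; rewrite -eac.
Qed.

Lemma dominates_trans a b c : dominates a b -> dominates b c -> dominates a c.
Proof. by move=> ab [lebc _]; apply: dominates_le_trans ab lebc. Qed.

End Dominance.

(** The anchor [a] makes the set of least elements nonempty, so [minimum] picks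
    one of them and not its default value. *)
Lemma minimum_image_le (R : realType) (T : Type) (A : set T) (f : T -> R) :
  (exists a, argmin A f a) -> forall b, A b -> minimum (f @` A) <= f b.
Proof.
move=> [a [Aa amin]] b Ab.
have least : ((f @` A) `&` lbound (f @` A)) (f a).
  by split; [exists a | move=> _ [c Ac <-]; apply: amin].
by have [_] := xgetPex 0 (ex_intro _ _ least); apply; exists b.
Qed.

(** Dominance is irreflexive, so letting a point compete with itself changes
    nothing; this reconciles the two forms of non-dominance in use. *)
Lemma pareto_frontE (R : realType) (P : problem R) (S : set (design P)) :
  pareto_front S =
  [set xs | S xs /\ ~ exists2 x, S x & dominates (J x) (J xs)].
Proof.
apply/seteqP; split=> xs [Sxs ndom]; split=> // -[x Sx dom]; apply: ndom.
  by exists x => //; split=> // exxs; apply: (@dominates_irrefl _ (J xs)); rewrite -{1}exxs.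
by exists x => //; case: Sx.
Qed.

Section Pruning.
Variables (R : realType) (P : problem R) (zk : subproblem P -> zvec P).
Hypothesis anchors : forall (k : subproblem P) (i : 'I_2),
  exists y : yvec P, argmin (subfeasible zk k) (subobjective zk k i) y.

Lemma utopia_le k x : subpareto zk k x -> forall i, utopia zk k i 0 <= J x i 0.
Proof.
case: x => y z [[/= fy ->] _] i; rewrite mxE.
exact: (minimum_image_le _ _ _ _ (anchors k i)).
Qed.

Lemma dominates_subpareto a k x :
  dominates a (utopia zk k) -> subpareto zk k x -> dominates a (J x).
Proof. by move=> ak /utopia_le; apply: dominates_le_trans. Qed.

(** If a master-front point of [l] pruned [k], the utopia point of [l] would
    dominate that of [k].  This contradicts the choice of [k] when [l] differs
    from [k], and irreflexivity of dominance when [l] is [k]. *)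
Lemma K1m_sub_K1u : K1m zk `<=` K1u zk.
Proof.
move=> k kmin [x [l _ xl] xk].
have lk : dominates (utopia zk l) (utopia zk k).
  exact: le_dominates_trans (utopia_le _ _ xl) xk.
apply: kmin; exists l => // elk.
by rewrite elk in lk; apply: dominates_irrefl lk.
Qed.

(** Discarding the pruned subproblems changes no non-dominated set: every point
    they offer is dominated by a point that is kept. *)
Lemma pareto_front_K1u :
  pareto_front (\bigcup_(k in K1u zk) subpareto zk k) =
  pareto_front (\bigcup_(k in [set: subproblem P]) subpareto zk k).
Proof.
rewrite !pareto_frontE; apply/seteqP; split=> xs [[k ku xk] ndom].
  split=> [|[x [l _ xl] dom]]; first by exists k.
  have [lu|/contrapT[w [m mm wm] wl]] := pselect (K1u zk l).
    by apply: ndom; exists x => //; exists l.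
  apply: ndom; exists w; first by exists m => //; apply: K1m_sub_K1u.
  exact: dominates_trans (dominates_subpareto _ _ _ wl xl) dom.
split=> [|[x [l _ xl] dom]]; last by apply: ndom; exists x => //; exists l.
exists k => // -[w [m _ wm] wk]; apply: ndom; exists w; first by exists m.
exact: dominates_subpareto wk xk.
Qed.

End Pruning.

Theorem proposition1 (R : realType) (P : problem R)
  (zk : subproblem P -> zvec P)
  (zk_enum : bijective zk)
  (anchors : forall (k : subproblem P) (i : 'I_2),
     exists y : yvec P, argmin (subfeasible zk k) (subobjective zk k i) y)
  (decomposition :
     pareto_optimal P =
     [set xs : design P | (\bigcup_(k in [set: subproblem P]) subpareto zk k) xs /\
        ~ exists2 x, (\bigcup_(k in [set: subproblem P]) subpareto zk k) x
                   & dominates (J x) (J xs)]) :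
  pareto_front (\bigcup_(k in K1u zk) subpareto zk k) = pareto_optimal P.
Proof.
by rewrite pareto_front_K1u // pareto_frontE decomposition.
Qed.
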